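(* Let $I$ be an index set and $p_r,q_r\in\mathbb C\setminus\{0\}$ for $r\in I$. There exists a homeomorphism $f\colon\mathbb C\to\mathbb C$ with $f(p_rw)=q_rf(w)$ for all $w\in\mathbb C$ and all $r\in I$ if and only if there exists a complex number $\alpha$ with $\operatorname{Re}\alpha>-1$ such that either $q_r=p_r|p_r|^{\alpha}$ for all $r\in I$, or $q_r=\overline{p_r}\,|p_r|^{\alpha}$ for all $r\in I$.
   Context: For a positive real $t$ and complex $\alpha$, $t^\alpha=e^{\alpha\ln t}$. *)

(* Defs.v *)
From Stdlib Require Import Reals.
Open Scope R_scope.

Definition Cplx : Type := (R * R)%type.

Definition Re (z : Cplx) : R := fst z.
Definition Im (z : Cplx) : R := snd z.

Definition C0 : Cplx := (0, 0).
Definition Cadd (z w : Cplx) : Cplx := (fst z + fst w, snd z + snd w).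
Definition Csub (z w : Cplx) : Cplx := (fst z - fst w, snd z - snd w).
Definition Cmul (z w : Cplx) : Cplx :=
  (fst z * fst w - snd z * snd w, fst z * snd w + snd z * fst w).
Definition Cconj (z : Cplx) : Cplx := (fst z, - snd z).
Definition Cnorm (z : Cplx) : R := sqrt (fst z * fst z + snd z * snd z).
Definition Cscale (t : R) (z : Cplx) : Cplx := (t * fst z, t * snd z).
Definition Cexp (z : Cplx) : Cplx := (exp (fst z) * cos (snd z), exp (fst z) * sin (snd z)).
Definition Rcpow (t : R) (alpha : Cplx) : Cplx := Cexp (Cscale (ln t) alpha).

Definition Ccontinuous (f : Cplx -> Cplx) : Prop :=
  forall z eps, 0 < eps -> exists delta, 0 < delta /\
    forall w, Cnorm (Csub w z) < delta -> Cnorm (Csub (f w) (f z)) < eps.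

Definition Chomeomorphism (f : Cplx -> Cplx) : Prop :=
  exists g : Cplx -> Cplx,
    (forall z, g (f z) = z) /\ (forall z, f (g z) = z) /\
    Ccontinuous f /\ Ccontinuous g.

(* Main.v *)
From Stdlib Require Import Reals ZArith Lra Lia Ranalysis5 ClassicalEpsilon.
From Coquelicot Require Import Coquelicot.
Require Import Defs.
Open Scope R_scope.

(** If [f 0 = 0], then [f] lifts through the exponential to a continuous [F] with
    [exp (F z) = f (exp z)], and [F (z + 2 pi i) = F z + 2 pi i s] with [s = 1] or
    [s = -1], because the lift of the inverse of [f] has the inverse degree. If
    [exp u = p_r], then [F (z + u) = F z + v] for a constant [v] with
    [exp v = q_r]. Suppose [Re u0 <> 0] for one such pair [(u0, v0)] and let [A] be
    the real-linear map with [A i = s i] and [A u0 = v0]. Then [F - A] is continuous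
    and periodic under the lattice spanned by [2 pi i] and [u0], hence bounded; it
    grows linearly along the multiples of [u] with slope [v - A u], so [v = A u].
    With [alpha = A 1 - 1] this is the claimed formula, and [Re (A 1) > 0] because
    [f] maps sequences tending to [0] to sequences tending to [0]. If every [u] is
    imaginary, periodicity under [2 pi i] is enough.

    Conversely [w |w|^alpha] and its composition with conjugation are equivariant
    homeomorphisms, the inverse of the former being [w |w|^beta] with
    [beta = - alpha / (1 + Re alpha)]. *)

(* [Cexp] with its type stated over Coquelicot's [C], so that [ring] and [field] apply. *)
Definition expC : C -> C := Cexp.

(** * Continuity of complex-valued functions *)

Section ComplexContinuity.

Context {U : UniformSpace}.

Lemma continuous_Cpair (f g : U -> R) (x : U) :
  continuous f x -> continuous g x ->
  continuous (fun y => (f y, g y) : C) x.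
Proof.
  intros Hf Hg P [e He].
  destruct (proj1 (filterlim_locally _ _) Hf e) as [d1 H1].
  destruct (proj1 (filterlim_locally _ _) Hg e) as [d2 H2].
  exists (mkposreal _ (Rmin_stable_in_posreal d1 d2)); intros y Hy; apply He; split.
  - apply H1; apply ball_le with (2 := Hy); apply Rmin_l.
  - apply H2; apply ball_le with (2 := Hy); apply Rmin_r.
Qed.

Lemma continuous_Cfst (f : U -> C) (x : U) :
  continuous f x -> continuous (fun y => fst (f y)) x.
Proof.
  intros Hf; apply continuous_comp with (1 := Hf).
  destruct (f x); apply continuous_fst.
Qed.

Lemma continuous_Csnd (f : U -> C) (x : U) :
  continuous f x -> continuous (fun y => snd (f y)) x.
Proof.
  intros Hf; apply continuous_comp with (1 := Hf).
  destruct (f x); apply continuous_snd.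
Qed.

Lemma continuous_Rplus (f g : U -> R) (x : U) :
  continuous f x -> continuous g x -> continuous (fun y => f y + g y) x.
Proof. exact (continuous_plus (V := R_NormedModule) f g x). Qed.

Lemma continuous_Rminus (f g : U -> R) (x : U) :
  continuous f x -> continuous g x -> continuous (fun y => f y - g y) x.
Proof. exact (continuous_minus (V := R_NormedModule) f g x). Qed.

Lemma continuous_Rmult (f g : U -> R) (x : U) :
  continuous f x -> continuous g x -> continuous (fun y => f y * g y) x.
Proof. exact (continuous_mult (K := R_AbsRing) f g x). Qed.

Lemma continuous_Cplus (f g : U -> C) (x : U) :
  continuous f x -> continuous g x -> continuous (fun y => (f y + g y)%C) x.
Proof.
  intros Hf Hg; apply continuous_Cpair; apply continuous_Rplus;
    now (apply continuous_Cfst || apply continuous_Csnd).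
Qed.

Lemma continuous_Cminus (f g : U -> C) (x : U) :
  continuous f x -> continuous g x -> continuous (fun y => (f y - g y)%C) x.
Proof.
  intros Hf Hg; apply continuous_Cpair; apply continuous_Rminus;
    now (apply continuous_Cfst || apply continuous_Csnd).
Qed.

Lemma continuous_Cmult (f g : U -> C) (x : U) :
  continuous f x -> continuous g x -> continuous (fun y => (f y * g y)%C) x.
Proof.
  intros Hf Hg; apply continuous_Cpair;
    [apply continuous_Rminus | apply continuous_Rplus]; apply continuous_Rmult;
    now (apply continuous_Cfst || apply continuous_Csnd).
Qed.

Lemma continuous_Cmod (f : U -> C) (x : U) :
  continuous f x -> continuous (fun y => Cmod (f y)) x.
Proof.
  intros Hf; apply (continuous_comp (fun y => fst (f y) ^ 2 + snd (f y) ^ 2) sqrt).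
  - simpl; apply continuous_Rplus; repeat apply continuous_Rmult;
      try apply continuous_const; now (apply continuous_Cfst || apply continuous_Csnd).
  - apply continuous_sqrt.
Qed.

Lemma continuous_Cinv (f : U -> C) (x : U) :
  f x <> 0%C -> continuous f x -> continuous (fun y => (/ f y)%C) x.
Proof.
  intros Hx Hf.
  assert (Hm : continuous (fun y => / (fst (f y) ^ 2 + snd (f y) ^ 2)) x).
  { apply (continuous_comp (fun y => fst (f y) ^ 2 + snd (f y) ^ 2) Rinv).
    - simpl; apply continuous_Rplus; repeat apply continuous_Rmult;
        try apply continuous_const; now (apply continuous_Cfst || apply continuous_Csnd).
    - apply continuous_Rinv; intros E; apply Hx.
      apply injective_projections; simpl; nra. }
  apply continuous_Cpair; apply continuous_Rmult; trivial.
  - now apply continuous_Cfst.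
  - apply (continuous_opp (V := R_NormedModule)); now apply continuous_Csnd.
Qed.

Lemma continuous_expC (f : U -> C) (x : U) :
  continuous f x -> continuous (fun y => expC (f y)) x.
Proof.
  intros Hf; apply continuous_Cpair; apply continuous_Rmult.
  - apply (continuous_comp (fun y => fst (f y)) exp);
      [now apply continuous_Cfst | apply continuous_exp].
  - apply (continuous_comp (fun y => snd (f y)) cos);
      [now apply continuous_Csnd | apply continuous_cos].
  - apply (continuous_comp (fun y => fst (f y)) exp);
      [now apply continuous_Cfst | apply continuous_exp].
  - apply (continuous_comp (fun y => snd (f y)) sin);
      [now apply continuous_Csnd | apply continuous_sin].
Qed.

End ComplexContinuity.

Lemma Cnorm_Cmod (z : C) : Cnorm z = Cmod z.
Proof. unfold Cnorm, Cmod; f_equal; ring. Qed.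

(** The uniform structure on [C] is that of the product, with squares as balls. Passing between the
    maximum of the coordinates and [Cmod] costs at most a factor [sqrt 2]. *)
Lemma continuous_C_iff (f : C -> C) (z : C) :
  continuous f z <->
  forall eps, 0 < eps -> exists delta, 0 < delta /\
    forall w, Cmod (w - z) < delta -> Cmod (f w - f z) < eps.
Proof.
  assert (two : 0 < sqrt 2) by (apply sqrt_lt_R0; lra).
  split.
  - intros Hf e He.
    assert (He' : 0 < e / sqrt 2) by now apply Rdiv_lt_0_compat.
    destruct (proj1 (filterlim_locally _ _) Hf (mkposreal _ He')) as [d Hd].
    exists d; split; [apply cond_pos|]; intros w Hw.
    assert (Hb : ball z d w).
    { assert (M := Rmax_Cmod (w - z)%C); split;
        refine (Rle_lt_trans _ _ _ _ Hw); refine (Rle_trans _ _ _ _ M);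
        [apply Rmax_l | apply Rmax_r]. }
    destruct (Hd w Hb) as [B1 B2].
    apply Rle_lt_trans with (1 := Cmod_2Rmax _).
    replace e with (sqrt 2 * (e / sqrt 2)) by (field; lra).
    apply Rmult_lt_compat_l; [exact two|]; apply Rmax_lub_lt; [exact B1 | exact B2].
  - intros H; apply (filterlim_locally (U := C_UniformSpace)); intros e.
    destruct (H e (cond_pos e)) as [d [d0 Hd]].
    assert (Hd' : 0 < d / sqrt 2) by now apply Rdiv_lt_0_compat.
    exists (mkposreal _ Hd'); intros w [B1 B2].
    assert (Hw : Cmod (w - z) < d).
    { apply Rle_lt_trans with (1 := Cmod_2Rmax _).
      replace d with (sqrt 2 * (d / sqrt 2)) by (field; lra).
      apply Rmult_lt_compat_l; [exact two|]; apply Rmax_lub_lt; [exact B1 | exact B2]. }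
    assert (M := Rmax_Cmod (f w - f z)%C); specialize (Hd w Hw); split;
      refine (Rle_lt_trans _ _ _ _ Hd); refine (Rle_trans _ _ _ _ M);
      [apply Rmax_l | apply Rmax_r].
Qed.

Lemma Ccontinuous_iff (f : C -> C) : Ccontinuous f <-> forall z, continuous f z.
Proof.
  split; intros H z.
  - apply continuous_C_iff; intros e He; destruct (H z e He) as [d [d0 Hd]].
    exists d; split; [exact d0|]; intros w; rewrite <- !Cnorm_Cmod; apply Hd.
  - intros e He; destruct (proj1 (continuous_C_iff f z) (H z) e He) as [d [d0 Hd]].
    exists d; split; [exact d0|]; intros w; rewrite !Cnorm_Cmod; apply Hd.
Qed.

(** * Complex exponential and logarithm *)

Lemma expC_plus (z w : C) : expC (z + w)%C = (expC z * expC w)%C.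
Proof.
  apply injective_projections; simpl; rewrite exp_plus.
  - rewrite cos_plus; ring.
  - rewrite sin_plus; ring.
Qed.

Lemma expC_0 : expC 0%C = 1%C.
Proof.
  apply injective_projections; simpl; rewrite exp_0; [rewrite cos_0 | rewrite sin_0]; ring.
Qed.

Lemma Cmod_expC (z : C) : Cmod (expC z) = exp (fst z).
Proof.
  unfold Cmod; simpl fst; simpl snd.
  replace (_ + _) with (Rsqr (exp (fst z))).
  - apply sqrt_Rsqr; left; apply exp_pos.
  - assert (H := sin2_cos2 (snd z)); unfold Rsqr in *; nra.
Qed.

Lemma expC_neq_0 (z : C) : expC z <> 0%C.
Proof. apply Cmod_gt_0; rewrite Cmod_expC; apply exp_pos. Qed.

Lemma expC_minus (z w : C) : expC (z - w)%C = (expC z / expC w)%C.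
Proof.
  assert (H := expC_neq_0 w).
  replace (expC z) with (expC (z - w)%C * expC w)%C.
  - field; exact H.
  - rewrite <- expC_plus; f_equal; ring.
Qed.

Lemma expC_eq_1 (z : C) :
  expC z = 1%C -> exists k : Z, z = (0, IZR k * (2 * PI)).
Proof.
  intros H.
  assert (H1 : fst z = 0).
  { apply exp_inv; rewrite exp_0, <- Cmod_expC, H; apply Cmod_1. }
  assert (H2 : cos (snd z) = 1).
  { apply (f_equal fst) in H; simpl in H; rewrite H1, exp_0 in H; lra. }
  replace (snd z) with (2 * (snd z / 2)) in H2 by field.
  rewrite cos_2a_sin in H2.
  destruct (sin_eq_0_0 (snd z / 2)) as [k Hk]; [nra|].
  exists k; apply injective_projections; simpl; lra.
Qed.

Lemma expC_2PI (k : Z) : expC (0, IZR k * (2 * PI)) = 1%C.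
Proof.
  assert (S : sin (IZR k * PI) = 0) by (apply sin_eq_0_1; now exists k).
  replace (IZR k * (2 * PI)) with (2 * (IZR k * PI)) by ring.
  apply injective_projections; cbn [expC Cexp fst snd RtoC]; rewrite exp_0.
  - rewrite cos_2a_sin, S; ring.
  - rewrite sin_2a, S; ring.
Qed.

(** The principal logarithm, meaningful on the right half-plane only: there [atan] of the slope is
    the argument. *)
Definition Clog (z : C) : C := (ln (Cmod z), atan (snd z / fst z)).

Lemma expC_Clog (z : C) : 0 < fst z -> expC (Clog z) = z.
Proof.
  intros Hz.
  assert (Hm : 0 < Cmod z).
  { apply Cmod_gt_0; intros E; rewrite E in Hz; simpl in Hz; lra. }
  (* Hence the cosine and sine of the arctangent are [fst z / Cmod z] and [snd z / Cmod z]. *)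
  assert (Hs : sqrt (1 + (snd z / fst z)²) = Cmod z / fst z).
  { apply sqrt_lem_1.
    - assert (H := Rle_0_sqr (snd z / fst z)); lra.
    - left; now apply Rdiv_lt_0_compat.
    - assert (H := Cmod2_alt z); unfold Complex.Re, Complex.Im in H.
      unfold Rsqr; field_simplify; [|lra..]; rewrite H; field; lra. }
  apply injective_projections; simpl; rewrite exp_ln by exact Hm;
    [rewrite cos_atan | rewrite sin_atan]; rewrite Hs; field; lra.
Qed.

Lemma continuous_Clog (z : C) : 0 < fst z -> continuous Clog z.
Proof.
  intros Hz.
  assert (Hm : 0 < Cmod z).
  { apply Cmod_gt_0; intros E; rewrite E in Hz; simpl in Hz; lra. }
  apply continuous_Cpair.
  - apply (continuous_comp Cmod ln); [apply (continuous_Cmod (fun y => y)), continuous_id |].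
    now apply continuous_ln.
  - apply (continuous_comp (fun y : C => snd y / fst y) atan); [|apply continuous_atan].
    apply continuous_Rmult; [apply (continuous_Csnd (fun y => y)), continuous_id|].
    apply (continuous_comp (fun y : C => fst y) Rinv).
    + apply (continuous_Cfst (fun y => y)), continuous_id.
    + apply continuous_Rinv; lra.
Qed.

(** A rotation by a half or quarter turn brings [z] into the right half-plane, where [Clog] applies;
    the added imaginary constant undoes the rotation. *)
Lemma expC_surj (z : C) : z <> 0%C -> exists u, expC u = z.
Proof.
  intros Hz.
  assert (E : forall y, expC (0, y) = (cos y, sin y)).
  { intros y; unfold expC, Cexp; simpl; rewrite exp_0; f_equal; ring. }
  destruct (Rtotal_order (fst z) 0) as [H | [H | H]].
  - exists (Clog (- z) + (0, PI)%R)%C.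
    rewrite expC_plus, expC_Clog, E, cos_PI, sin_PI by (simpl; lra).
    apply injective_projections; simpl; ring.
  - destruct (Rtotal_order (snd z) 0) as [K | [K | K]].
    + exists (Clog (z * (0, 1))%C + (0, - (PI / 2))%R)%C.
      rewrite expC_plus, expC_Clog, E, cos_neg, sin_neg, cos_PI2, sin_PI2 by (simpl; lra).
      apply injective_projections; simpl; ring.
    + now destruct Hz; apply injective_projections.
    + exists (Clog (z * (0, - (1))%R)%C + (0, PI / 2)%R)%C.
      rewrite expC_plus, expC_Clog, E, cos_PI2, sin_PI2 by (simpl; lra).
      apply injective_projections; simpl; ring.
  - exists (Clog z); now apply expC_Clog.
Qed.

(** * Lifting through the exponential *)

Lemma expC_eq (z w : C) :
  expC z = expC w -> exists k : Z, z = (w + (0, IZR k * (2 * PI))%R)%C.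
Proof.
  intros E; destruct (expC_eq_1 (z - w)) as [k Hk].
  - rewrite expC_minus, E; field; apply expC_neq_0.
  - exists k; rewrite <- Hk; ring.
Qed.

Lemma integer_path_const (h : R -> R) :
  (forall t, 0 <= t <= 1 -> continuous h t) ->
  (forall t, 0 <= t <= 1 -> exists k : Z, h t = IZR k) -> h 1 = h 0.
Proof.
  assert (key : forall h : R -> R, (forall t, 0 <= t <= 1 -> continuous h t) ->
    (forall t, 0 <= t <= 1 -> exists k : Z, h t = IZR k) -> h 1 <= h 0).
  { clear h; intros h Hc Hk.
    destruct (Rle_or_lt (h 1) (h 0)) as [L | L]; [exact L|exfalso].
    destruct (Hk 0) as [k0 K0]; [lra|]; destruct (Hk 1) as [k1 K1]; [lra|].
    rewrite K0, K1 in L; apply lt_IZR in L.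
    assert (L' : IZR k0 + 1 <= IZR k1) by (rewrite <- plus_IZR; apply IZR_le; lia).
    (* If [h] grew by at least 1, it would take the non-integer value [h 0 + / 2]. *)
    destruct (IVT_interv (fun t => h t - (h 0 + / 2)) 0 1) as [z [Hz E]].
    - intros t Ht; apply continuity_pt_filterlim.
      apply (continuous_Rminus h (fun _ => h 0 + / 2)); [now apply Hc|].
      apply continuous_const.
    - lra.
    - lra.
    - lra.
    - destruct (Hk z Hz) as [k K]; rewrite K, K0 in E.
      assert (E' : IZR (2 * (k - k0)) = IZR 1)
        by (rewrite mult_IZR, minus_IZR; lra).
      apply eq_IZR in E'; lia. }
  intros Hc Hk; apply Rle_antisym; [now apply key|].
  apply Ropp_le_cancel, (key (fun t => - h t)).
  - intros t Ht; apply (continuous_opp (V := R_NormedModule)); now apply Hc.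
  - intros t Ht; destruct (Hk t Ht) as [k K]; exists (- k)%Z; rewrite opp_IZR; lra.
Qed.

Lemma continuous_ray (z : C) (t : R) : continuous (fun t : R => (t * z)%C) t.
Proof.
  apply (continuous_Cmult (fun t : R => RtoC t) (fun _ => z)).
  - apply (continuous_Cpair (fun t => t) (fun _ => 0));
      [apply continuous_id | apply continuous_const].
  - apply continuous_const.
Qed.

(** Along the segment from [0] to [z], [h] differs from [h 0] by an integer multiple of [2 pi i]
    that varies continuously and so stays [0]. Using only the segment makes this applicable on
    discs. *)
Lemma expC_ray_const (h : C -> C) (z : C) :
  (forall t : R, 0 <= t <= 1 -> continuous h (t * z)%C) ->
  (forall t : R, 0 <= t <= 1 -> expC (h (t * z)%C) = expC (h 0%C)) ->
  h z = h 0%C.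
Proof.
  intros Hc He.
  assert (Hh : forall t : R, 0 <= t <= 1 ->
            continuous (fun t : R => h (t * z)%C) t).
  { intros t Ht; apply (continuous_comp (fun t : R => (t * z)%C) h);
      [apply continuous_ray | now apply Hc]. }
  assert (E0 : (0 * z)%C = 0%C) by ring.
  assert (E1 : (1 * z)%C = z) by ring.
  assert (P := PI_RGT_0).
  assert (F : forall t : R, 0 <= t <= 1 -> fst (h (t * z)%C) = fst (h 0%C)).
  { intros t Ht; destruct (expC_eq _ _ (He t Ht)) as [k ->]; simpl; ring. }
  assert (S := integer_path_const
    (fun t => (snd (h (t * z)%C) - snd (h 0%C)) * / (2 * PI))).
  cbv beta in S; rewrite E0, E1 in S.
  apply injective_projections.
  - rewrite <- (F 1), E1 by lra; reflexivity.
  - apply Rminus_diag_uniq, (Rmult_eq_reg_r (/ (2 * PI))).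
    + rewrite S; [ring | |].
      * intros t Ht; apply continuous_Rmult; [|apply continuous_const].
        apply continuous_Rminus; [|apply continuous_const].
        now apply continuous_Csnd, Hh.
      * intros t Ht; destruct (expC_eq _ _ (He t Ht)) as [k ->]; exists k.
        simpl; field; lra.
    + apply Rinv_neq_0_compat; lra.
Qed.

Lemma expC_const (h : C -> C) (a : C) :
  (forall z, continuous h z) -> (forall z, expC (h z) = a) ->
  forall z, h z = h 0%C.
Proof.
  intros Hc He z; apply expC_ray_const; [now intros|].
  intros t _; now rewrite !He.
Qed.

(** Continuity attaches a radius to every point, and compactness of the square of side [2 * N] turns
    these into one [d]. The centre [u] serves both points: in each coordinate [z] is within its
    radius and [w] within twice that. *)
Lemma lebesgue_number (h : C -> C) (e : C -> R) (N : R) :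
  (forall z, continuous h z) -> (forall z, 0 < e z) ->
  exists d, 0 < d /\ forall z w, Cmod z <= N -> Cmod (w - z) < d ->
    exists u, Cmod (h z - h u) < e u /\ Cmod (h w - h u) < e u.
Proof.
  intros Hc He.
  assert (D : forall x y, {d : posreal | forall w : C,
    Rabs (fst w - x) < 2 * d -> Rabs (snd w - y) < 2 * d ->
    Cmod (h w - h (x, y)) < e (x, y)}).
  { intros x y; apply constructive_indefinite_description.
    destruct (proj1 (continuous_C_iff h (x, y)) (Hc (x, y)) _ (He (x, y))) as [d [d0 Hd]].
    (* A quarter of the continuity radius: after doubling, each coordinate is within half of it, and
       [sqrt 2 <= 2] absorbs the change of norm. *)
    assert (d4 : 0 < d / 4) by lra.
    exists (mkposreal _ d4); simpl; unfold Rminus; intros w Hx Hy; apply Hd.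
    apply Rle_lt_trans with (1 := Cmod_2Rmax _); simpl.
    assert (S : sqrt 2 <= 2).
    { rewrite <- (sqrt_square 2) at 2 by lra; apply sqrt_le_1_alt; lra. }
    assert (S0 := sqrt_pos 2).
    assert (M : Rmax (Rabs (fst w + - x)) (Rabs (snd w + - y)) < d / 2)
      by (apply Rmax_lub_lt; lra).
    assert (M0 := Rmax_l (Rabs (fst w + - x)) (Rabs (snd w + - y))).
    assert (M1 := Rabs_pos (fst w + - x)); nra. }
  destruct (compactness_value_2d (- N) N (- N) N (fun x y => proj1_sig (D x y)))
    as [d Hd].
  exists d; split; [apply cond_pos|]; intros z w Hz Hw.
  assert (B : - N <= fst z <= N /\ - N <= snd z <= N).
  { assert (M := Rmax_Cmod z).
    assert (M1 := Rmax_l (Rabs (fst z)) (Rabs (snd z))).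
    assert (M2 := Rmax_r (Rabs (fst z)) (Rabs (snd z))).
    split; apply Rabs_le_between; lra. }
  destruct B as [B1 B2].
  destruct (NNPP _ (Hd _ _ B1 B2)) as (u & v & _ & _ & K1 & K2 & K).
  exists (u, v); destruct (D u v) as [d' Hd']; simpl in K1, K2, K.
  assert (M := Rmax_Cmod (w - z)%C); simpl in M.
  assert (M1 := Rmax_l (Rabs (fst w + - fst z)) (Rabs (snd w + - snd z))).
  assert (M2 := Rmax_r (Rabs (fst w + - fst z)) (Rabs (snd w + - snd z))).
  assert (d0 := cond_pos d').
  split; apply Hd'; try lra.
  - replace (fst w - u) with ((fst w + - fst z) + (fst z - u)) by ring.
    apply Rle_lt_trans with (1 := Rabs_triang _ _); lra.
  - replace (snd w - v) with ((snd w + - snd z) + (snd z - v)) by ring.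
    apply Rle_lt_trans with (1 := Rabs_triang _ _); lra.
Qed.

(** With tolerance [Cmod (h u) / 4], the values [h w] and [h z] differ by less than half of
    [Cmod (h u)], while [Cmod (h z)] exceeds three quarters of it. So the ratio is within 1 of 1. *)
Lemma ratio_right_half_plane (h : C -> C) (N : R) :
  (forall z, continuous h z) -> (forall z, h z <> 0%C) ->
  exists d, 0 < d /\ forall z w, Cmod z <= N -> Cmod (w - z) < d ->
    0 < fst (h w / h z)%C.
Proof.
  intros Hc H0.
  destruct (lebesgue_number h (fun u => Cmod (h u) / 4) N Hc) as [d [d0 Hd]].
  { intros z; assert (H := proj1 (Cmod_gt_0 _) (H0 z)); lra. }
  exists d; split; [exact d0|]; intros z w Hz Hw.
  destruct (Hd z w Hz Hw) as [u [K1 K2]].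
  assert (T1 : Cmod (h w - h z) < Cmod (h u) / 2).
  { replace (h w - h z)%C with ((h w - h u) + - (h z - h u))%C by ring.
    apply Rle_lt_trans with (1 := Cmod_triangle _ _); rewrite Cmod_opp; lra. }
  assert (T2 : Cmod (h u) <= Cmod (h z) + Cmod (h z - h u)).
  { replace (h u) with (h z + - (h z - h u))%C at 1 by ring.
    apply Rle_trans with (1 := Cmod_triangle _ _); rewrite Cmod_opp; lra. }
  assert (P := proj1 (Cmod_gt_0 _) (H0 z)).
  assert (Q := Cmod_ge_0 (h u)).
  assert (L : Cmod (h w / h z - 1) < 1).
  { replace (h w / h z - 1)%C with ((h w - h z) / h z)%C by (field; apply H0).
    rewrite Cmod_div by apply H0; apply Rlt_div_l; lra. }
  assert (A := re_le_Cmod (h w / h z - 1)%C).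
  assert (A' : Rabs (fst (h w / h z)%C - 1) < 1).
  { apply Rle_lt_trans with (2 := L); apply Rle_trans with (2 := A); right; reflexivity. }
  apply Rabs_lt_between in A'; lra.
Qed.

(* A logarithm of [h (k/n z)] when [expC l = h 0] and every step
   [h ((j+1)/n z) / h (j/n z)] has positive real part. *)
Fixpoint log_sum (h : C -> C) (l : C) (n : R) (k : nat) (z : C) : C :=
  match k with
  | O => l
  | S j => (log_sum h l n j z
            + Clog (h ((INR (S j) / n)%R * z) / h ((INR j / n)%R * z)))%C
  end.

(** The segment from [0] to [z] is cut into [n] equal steps so short that all successive ratios of
    [h] lie in the domain of [Clog]. Adding their logarithms to [l] makes the exponentials telescope
    to [h z]. *)
Lemma lift_disc (h : C -> C) (l : C) (N : R) :
  (forall z, continuous h z) -> (forall z, h z <> 0%C) -> expC l = h 0%C ->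
  exists F : C -> C, F 0%C = l /\
    forall z, Cmod z < N -> continuous F z /\ expC (F z) = h z.
Proof.
  intros Hc H0 Hl.
  destruct (ratio_right_half_plane h N Hc H0) as [d [d0 Hd]].
  destruct (Rle_or_lt N 0) as [N0 | N0].
  { exists (fun _ => l); split; [reflexivity|]; intros z Hz.
    assert (Q := Cmod_ge_0 z); lra. }
  destruct (archimed_cor1 (d / N)) as [n [Hn n0]]; [now apply Rdiv_lt_0_compat|].
  assert (n1 : 0 < INR n) by now apply lt_0_INR.
  assert (R1 : forall k z, (k < n)%nat -> Cmod z < N ->
     0 < fst (h ((INR (S k) / INR n)%R * z) / h ((INR k / INR n)%R * z))%C).
  { intros k z Hk Hz.
    assert (Q := Cmod_ge_0 z).
    assert (k0 := pos_INR k).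
    assert (k1 : INR k <= INR n) by (apply le_INR; lia).
    apply Hd.
    - rewrite Cmod_mult, Cmod_R, Rabs_pos_eq by (apply Rle_div_r; lra).
      assert (INR k / INR n <= 1) by (apply Rle_div_l; lra); nra.
    - replace (_ - _)%C with ((/ INR n)%R * z)%C.
      + rewrite Cmod_mult, Cmod_R, Rabs_pos_eq by (left; now apply Rinv_0_lt_compat).
        assert (I := Rinv_0_lt_compat _ n1).
        apply Rle_lt_trans with (/ INR n * N); [nra|].
        replace d with (d / N * N) by (field; lra).
        now apply Rmult_lt_compat_r.
      + rewrite S_INR; apply injective_projections; simpl; field; lra. }
  assert (E : forall k z, (k <= n)%nat -> Cmod z < N ->
     continuous (log_sum h l (INR n) k) z /\
     expC (log_sum h l (INR n) k z) = h ((INR k / INR n)%R * z)%C).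
  { induction k as [|k IH]; intros z Hk Hz.
    - split; [apply continuous_const|]; simpl.
      rewrite Hl; f_equal; apply injective_projections; simpl; field; lra.
    - destruct (IH z) as [I1 I2]; [lia | exact Hz |].
      assert (Hlin : forall c : R, continuous (fun z => h (c * z)%C) z).
      { intros c; apply (continuous_comp (fun z => c * z)%C h); [|apply Hc].
        apply (continuous_Cmult (fun _ => RtoC c) (fun z => z));
          [apply continuous_const | apply continuous_id]. }
      split.
      + apply (continuous_Cplus (log_sum h l (INR n) k)); [exact I1|].
        apply (continuous_comp (fun z =>
          (h ((INR (S k) / INR n)%R * z) / h ((INR k / INR n)%R * z))%C) Clog).
        * apply continuous_Cmult; [apply Hlin|]; apply continuous_Cinv; [apply H0|apply Hlin].
        * apply continuous_Clog, R1; [lia | exact Hz].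
      + cbn [log_sum]; rewrite expC_plus, I2, expC_Clog by (apply R1; [lia | exact Hz]).
        field; apply H0. }
  exists (log_sum h l (INR n) n); split.
  (* At [z = 0] every ratio is 1, so every summand [Clog 1] vanishes. *)
  - clear - H0; generalize (INR n) as x; induction n as [|n IH]; intros x; [reflexivity|].
    cbn [log_sum]; rewrite IH, !Cmult_0_r.
    replace (h 0 / h 0)%C with (RtoC 1) by (field; apply H0).
    unfold Clog; rewrite Cmod_1, ln_1; simpl.
    unfold Rdiv; rewrite Rmult_0_l, atan_0.
    apply injective_projections; simpl; ring.
  - intros z Hz; destruct (E n z (le_n _) Hz) as [E1 E2]; split; [exact E1|].
    rewrite E2; f_equal; replace (INR n / INR n) with 1 by (field; lra); ring.
Qed.

Lemma lift_disc_unique (F1 F2 h : C -> C) (N : R) :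
  F1 0%C = F2 0%C ->
  (forall z, Cmod z < N -> continuous F1 z /\ expC (F1 z) = h z) ->
  (forall z, Cmod z < N -> continuous F2 z /\ expC (F2 z) = h z) ->
  forall z, Cmod z < N -> F1 z = F2 z.
Proof.
  intros E H1 H2 z Hz.
  assert (B : forall t : R, 0 <= t <= 1 -> Cmod (t * z) < N).
  { intros t Ht; rewrite Cmod_mult, Cmod_R, Rabs_pos_eq by lra.
    assert (Q := Cmod_ge_0 z); nra. }
  assert (D : (F1 z - F2 z)%C = (F1 0 - F2 0)%C).
  { apply (expC_ray_const (fun w => F1 w - F2 w)%C).
    - intros t Ht; apply continuous_Cminus; [apply H1 | apply H2]; now apply B.
    - intros t Ht; rewrite !expC_minus.
      rewrite (proj2 (H1 _ (B t Ht))), <- (proj2 (H2 _ (B t Ht))), E.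
      field; split; apply expC_neq_0. }
  replace (F1 z) with ((F1 z - F2 z) + F2 z)%C by ring.
  rewrite D, E; ring.
Qed.

(** Lifts on discs of all radii are chosen with the same value [l] at [0], so they agree on overlaps
    by uniqueness and glue together. *)
Lemma lift_plane (h : C -> C) :
  (forall z, continuous h z) -> (forall z, h z <> 0%C) ->
  exists F : C -> C,
    (forall z, continuous F z) /\ (forall z, expC (F z) = h z).
Proof.
  intros Hc H0.
  destruct (expC_surj (h 0%C) (H0 _)) as [l Hl].
  assert (L := fun N => constructive_indefinite_description _
                          (lift_disc h l N Hc H0 Hl)).
  set (G := fun N => proj1_sig (L N)).
  assert (G0 : forall N, G N 0%C = l) by (intros N; apply (proj2_sig (L N))).
  assert (GN : forall N z, Cmod z < N -> continuous (G N) z /\ expC (G N z) = h z)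
    by (intros N; apply (proj2_sig (L N))).
  assert (GG : forall N M z, Cmod z < N -> Cmod z < M -> G N z = G M z).
  { intros N M z HN HM.
    apply (lift_disc_unique (G N) (G M) h (Rmin N M)).
    - now rewrite !G0.
    - intros w Hw; apply GN; assert (K := Rmin_l N M); lra.
    - intros w Hw; apply GN; assert (K := Rmin_r N M); lra.
    - now apply Rmin_glb_lt. }
  (* The radius [Cmod z + 1] leaves room around [z], so that near [z] the glued map coincides with a
     single [G (Cmod z + 1)]. *)
  exists (fun z => G (Cmod z + 1) z); split; intros z.
  - assert (Hz : Cmod z < Cmod z + 1) by lra.
    apply (continuous_ext_loc _ (G (Cmod z + 1))); [|now apply GN].
    assert (K := continuous_Cmod (fun z => z) z (continuous_id z)).
    generalize (proj1 (filterlim_locally _ _) K (mkposreal 1 Rlt_0_1)).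
    apply filter_imp; intros w Hw; apply GG; [|lra].
    apply Rabs_lt_between in Hw; unfold minus, plus, opp in Hw; simpl in Hw; lra.
  - apply GN; lra.
Qed.

(** * Quasi-periodic functions *)

(** One [n] works for the whole disc: going from [0] to [z] in [n] equal steps, each step changes
    [h] by less than [/ 2 + / 2 = 1]. *)
Lemma continuous_bounded_disc (h : C -> C) (N : R) :
  (forall z, continuous h z) ->
  exists B, forall z, Cmod z <= N -> Cmod (h z) <= B.
Proof.
  intros Hc.
  destruct (lebesgue_number h (fun _ => / 2) N Hc) as [d [d0 Hd]]; [intros; lra|].
  destruct (Rle_or_lt N 0) as [N0 | N0].
  { exists (Cmod (h 0%C)); intros z Hz.
    rewrite (Cmod_eq_0 z); [right; reflexivity|].
    apply Rle_antisym; [lra | apply Cmod_ge_0]. }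
  destruct (archimed_cor1 (d / N)) as [n [Hn n0]]; [now apply Rdiv_lt_0_compat|].
  assert (n1 : 0 < INR n) by now apply lt_0_INR.
  assert (I := Rinv_0_lt_compat _ n1).
  assert (St : / INR n * N < d).
  { replace d with (d / N * N) by (field; lra).
    now apply Rmult_lt_compat_r. }
  exists (INR n + Cmod (h 0%C)); intros z Hz.
  assert (Q := Cmod_ge_0 z).
  assert (K : forall k, (k <= n)%nat ->
    Cmod (h ((INR k / INR n)%R * z)%C) <= INR k + Cmod (h 0%C)).
  { induction k as [|k IH]; intros Hk.
    - right; simpl INR; rewrite Rplus_0_l; do 2 f_equal.
      apply injective_projections; simpl; field; lra.
    - assert (k0 := pos_INR k).
      assert (k1 : INR k <= INR n) by (apply le_INR; lia).
      destruct (Hd ((INR k / INR n)%R * z)%C ((INR (S k) / INR n)%R * z)%C)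
        as [u [U1 U2]].
      + rewrite Cmod_mult, Cmod_R, Rabs_pos_eq by (apply Rle_div_r; lra).
        assert (INR k / INR n <= 1) by (apply Rle_div_l; lra); nra.
      + replace (_ - _)%C with ((/ INR n)%R * z)%C.
        * rewrite Cmod_mult, Cmod_R, Rabs_pos_eq by lra; nra.
        * rewrite S_INR; apply injective_projections; simpl; field; lra.
      + replace (h ((INR (S k) / INR n)%R * z)%C) with
          ((h ((INR (S k) / INR n)%R * z) - h u)
           + (- (h ((INR k / INR n)%R * z) - h u) + h ((INR k / INR n)%R * z)))%C by ring.
        apply Rle_trans with (1 := Cmod_triangle _ _).
        apply Rle_trans with (1 := Rplus_le_compat_l _ _ _ (Cmod_triangle _ _)).
        rewrite Cmod_opp; assert (E := S_INR k).
        specialize (IH ltac:(lia)); lra. }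
  specialize (K n (le_n _)).
  replace ((INR n / INR n)%R * z)%C with z in K; [exact K|].
  apply injective_projections; simpl; field; lra.
Qed.

Definition quasi_period (F : C -> C) (u v : C) : Prop :=
  forall z, F (z + u)%C = (F z + v)%C.

Lemma quasi_period_opp (F : C -> C) (u v : C) :
  quasi_period F u v -> quasi_period F (- u) (- v).
Proof.
  intros H z; replace (F z) with (F ((z + - u) + u)%C) by (f_equal; ring).
  rewrite H; ring.
Qed.

Lemma quasi_period_plus (F : C -> C) (u v u' v' : C) :
  quasi_period F u v -> quasi_period F u' v' ->
  quasi_period F (u + u') (v + v').
Proof.
  intros H H' z; rewrite Cplus_assoc, H', H; ring.
Qed.

Lemma quasi_period_nat (F : C -> C) (u v : C) (n : nat) :
  quasi_period F u v -> quasi_period F (INR n * u) (INR n * v).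
Proof.
  intros H; induction n as [|n IH].
  - intros z; simpl INR; rewrite !Cmult_0_l, Cplus_0_r; ring.
  - replace (INR (S n) * u)%C with (INR n * u + u)%C
      by (rewrite S_INR, RtoC_plus; ring).
    replace (INR (S n) * v)%C with (INR n * v + v)%C
      by (rewrite S_INR, RtoC_plus; ring).
    now apply quasi_period_plus.
Qed.

Lemma quasi_period_Z (F : C -> C) (u v : C) (m : Z) :
  quasi_period F u v -> quasi_period F (IZR m * u) (IZR m * v).
Proof.
  intros H; destruct (Z.le_gt_cases 0 m) as [L | L].
  - rewrite <- (Z2Nat.id m) by exact L; rewrite <- INR_IZR_INZ.
    now apply quasi_period_nat.
  - replace m with (- Z.of_nat (Z.to_nat (- m)))%Z by lia.
    rewrite opp_IZR, <- INR_IZR_INZ.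
    replace (RtoC (- INR (Z.to_nat (- m))) * u)%C
      with (- (INR (Z.to_nat (- m)) * u))%C by (rewrite RtoC_opp; ring).
    replace (RtoC (- INR (Z.to_nat (- m))) * v)%C
      with (- (INR (Z.to_nat (- m)) * v))%C by (rewrite RtoC_opp; ring).
    now apply quasi_period_opp, quasi_period_nat.
Qed.

(** By periodicity [P (n u - s) = P 0 + n v], and [n u - s] stays in a disc on which [P] is bounded.
    So [n * Cmod v] is bounded over all [n]. *)
Lemma quasi_period_bounded (P : C -> C) (u v : C) (N : R) :
  (forall z, continuous P z) -> quasi_period P u v ->
  (forall n : nat, exists s, quasi_period P s 0 /\ Cmod (INR n * u - s) <= N) ->
  v = 0%C.
Proof.
  intros Hc Hu Hs.
  destruct (continuous_bounded_disc P N Hc) as [B HB].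
  assert (L : forall n : nat, INR n * Cmod v <= B + Cmod (P 0%C)).
  { intros n; destruct (Hs n) as [s [Ps Ns]].
    assert (E := quasi_period_nat P u v n Hu 0%C).
    rewrite <- (Rabs_pos_eq (INR n)), <- Cmod_R, <- Cmod_mult by apply pos_INR.
    replace (INR n * v)%C with (P (INR n * u - s)%C + - P 0%C)%C.
    - apply Rle_trans with (1 := Cmod_triangle _ _); rewrite Cmod_opp.
      apply Rplus_le_compat_r, HB, Ns.
    - replace (P (INR n * u - s)%C) with (P (INR n * u - s + s)%C)
        by (rewrite Ps; ring).
      replace (INR n * u - s + s)%C with (0 + INR n * u)%C by ring.
      rewrite E; ring. }
  apply Cmod_eq_0; destruct (Cmod_ge_0 v) as [V | V]; [exfalso | easy].
  destruct (INR_archimed (Cmod v) (B + Cmod (P 0%C)) V) as [n Hn].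
  specialize (L n); lra.
Qed.

(** The real-linear map [A] with [A 1 = c] and [A i = s i]. *)
Definition shear (c : C) (s : R) (z : C) : C :=
  (fst z * c + (0, s * snd z)%R)%C.

Lemma shear_plus (c : C) (s : R) (z w : C) :
  shear c s (z + w) = (shear c s z + shear c s w)%C.
Proof. apply injective_projections; simpl; ring. Qed.

Lemma continuous_shear (c : C) (s : R) (z : C) : continuous (shear c s) z.
Proof.
  apply continuous_Cplus.
  - apply continuous_Cmult; [|apply continuous_const].
    apply continuous_Cpair; [|apply continuous_const].
    apply (continuous_Cfst (fun y => y)), continuous_id.
  - apply continuous_Cpair; [apply continuous_const|].
    apply continuous_Rmult; [apply continuous_const|].
    apply (continuous_Csnd (fun y => y)), continuous_id.
Qed.

(* [F - shear c s] is periodic under [2 pi i] and [u0], hence bounded along the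
   multiples of [u], while it grows linearly there with slope [v - shear c s u]. *)
Lemma quasi_period_shear (F : C -> C) (c : C) (s : R) (u v : C) :
  (forall z, continuous F z) ->
  quasi_period F (0, 2 * PI) (0, s * (2 * PI)) ->
  quasi_period F u v ->
  (fst u = 0 \/ exists u0, fst u0 <> 0 /\ quasi_period F u0 (shear c s u0)) ->
  v = shear c s u.
Proof.
  intros Hc H2 Hu Hor.
  set (P := fun z => (F z - shear c s z)%C).
  assert (Pc : forall z, continuous P z).
  { intros z; apply continuous_Cminus; [apply Hc | apply continuous_shear]. }
  assert (PP : forall a b, quasi_period F a b -> quasi_period P a (b - shear c s a)).
  { intros a b H z; unfold P; rewrite H, shear_plus; ring. }
  assert (P2 : forall k : Z, quasi_period P (IZR k * (0, 2 * PI)%R) 0).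
  { intros k; replace (RtoC 0) with (IZR k * ((0, s * (2 * PI))%R - shear c s (0, 2 * PI)%R))%C
      by (apply injective_projections; simpl; ring).
    now apply quasi_period_Z, PP. }
  assert (two_pi : Cmod (0, 2 * PI) = 2 * PI).
  { unfold Cmod; simpl; replace (_ + _) with (2 * PI * (2 * PI)) by ring.
    apply sqrt_square; assert (H := PI_RGT_0); lra. }
  assert (P0 := PI_RGT_0).
  assert (frac : forall x, Rabs (x - IZR (Int_part x)) <= 1).
  { intros x; destruct (base_Int_part x); apply Rabs_le; lra. }
  enough (E : (v - shear c s u)%C = 0%C)
    by (replace v with ((v - shear c s u) + shear c s u)%C by ring; rewrite E; ring).
  destruct Hor as [Hre | [u0 [Hre H0]]].
  - apply (quasi_period_bounded P u _ (2 * PI) Pc (PP _ _ Hu)).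
    (* Here [n u] is purely imaginary, so reducing it modulo [2 pi i] leaves a remainder of modulus
       at most [2 * PI]. *)
    intros n; set (y := INR n * snd u / (2 * PI)).
    exists (IZR (Int_part y) * (0, 2 * PI)%R)%C; split; [apply P2|].
    replace (_ - _)%C with ((y - IZR (Int_part y))%R * (0, 2 * PI)%R)%C.
    + rewrite Cmod_mult, Cmod_R, two_pi; specialize (frac y); nra.
    + unfold y; apply injective_projections; simpl; rewrite ?Hre; field; lra.
  - apply (quasi_period_bounded P u _ (Cmod u0 + 2 * PI) Pc (PP _ _ Hu)).
    (* [x] and [y] are the real coordinates of [n u] in the basis [u0], [2 pi i]. Their integer
       parts give the lattice point to subtract, and their fractional parts bound the remainder. *)
    intros n; set (x := INR n * fst u / fst u0).
    set (y := (INR n * snd u - x * snd u0) / (2 * PI)).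
    exists (IZR (Int_part x) * u0 + IZR (Int_part y) * (0, 2 * PI)%R)%C; split.
    + replace (RtoC 0) with (IZR (Int_part x) * (shear c s u0 - shear c s u0) + 0)%C by ring.
      apply quasi_period_plus; [|apply P2]; now apply quasi_period_Z, PP.
    + replace (_ - _)%C with ((x - IZR (Int_part x))%R * u0
         + (y - IZR (Int_part y))%R * (0, 2 * PI)%R)%C.
      * apply Rle_trans with (1 := Cmod_triangle _ _).
        rewrite !Cmod_mult, !Cmod_R, two_pi.
        assert (fx := frac x); assert (fy := frac y).
        assert (Q := Cmod_ge_0 u0); nra.
      * unfold y, x; apply injective_projections; simpl; field; lra.
Qed.

(** * Lifts of equivariant homeomorphisms *)

(** The difference [F (z + u) - F z] is continuous in [z] and its exponential is always [q], so it
    is constant. *)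
Lemma lift_quasi_period (f F : C -> C) (p q u : C) :
  (forall z, continuous F z) -> (forall z, expC (F z) = f (expC z)) ->
  (forall w, f (p * w)%C = (q * f w)%C) -> expC u = p ->
  exists v, expC v = q /\ quasi_period F u v.
Proof.
  intros Hc HF Hf Hu.
  assert (E : forall z, expC (F (z + u)%C - F z)%C = q).
  { intros z; rewrite expC_minus, !HF, expC_plus, Hu, Cmult_comm, Hf, <- HF.
    field; apply expC_neq_0. }
  exists (F (0 + u)%C - F 0%C)%C; split; [apply E|]; intros z.
  rewrite <- (expC_const (fun z => F (z + u)%C - F z)%C q) with (z := z); [ring| |exact E].
  intros w; apply continuous_Cminus; [|apply Hc].
  apply (continuous_comp (fun z => z + u)%C F); [|apply Hc].
  apply continuous_Cplus; [apply continuous_id | apply continuous_const].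
Qed.

Lemma lift_2PI (f F : C -> C) :
  (forall z, continuous F z) -> (forall z, expC (F z) = f (expC z)) ->
  exists d : Z, quasi_period F (0, 2 * PI) (0, IZR d * (2 * PI)).
Proof.
  intros Hc HF.
  destruct (lift_quasi_period f F 1 1 (0, 2 * PI) Hc HF) as [v [Hv Q]].
  - intros w; now rewrite !Cmult_1_l.
  - rewrite <- (expC_2PI 1); f_equal; f_equal; ring.
  - destruct (expC_eq_1 v Hv) as [d ->]; now exists d.
Qed.

Lemma homeo_lift (f g : C -> C) :
  (forall z, continuous f z) -> (forall z, continuous g z) ->
  (forall z, g (f z) = z) -> (forall z, f (g z) = z) -> f 0%C = 0%C ->
  exists (F : C -> C) (s : R), (s = 1 \/ s = -1) /\
    (forall z, continuous F z) /\ (forall z, expC (F z) = f (expC z)) /\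
    quasi_period F (0, 2 * PI) (0, s * (2 * PI)).
Proof.
  intros Hf Hg gf fg f0.
  assert (g0 : g 0%C = 0%C) by (now rewrite <- f0 at 1).
  assert (Ec : forall h : C -> C, (forall z, continuous h z) ->
            forall z, continuous (fun z => h (expC z)) z).
  { intros h Hh z; apply (continuous_comp expC h); [|apply Hh].
    apply (continuous_expC (fun z => z)), continuous_id. }
  destruct (lift_plane (fun z => f (expC z))) as [F [Fc HF]]; [now apply Ec| |].
  { intros z E; apply (expC_neq_0 z); rewrite <- (gf (expC z)), E; exact g0. }
  destruct (lift_plane (fun z => g (expC z))) as [K [Kc HK]]; [now apply Ec| |].
  { intros z E; apply (expC_neq_0 z); rewrite <- (fg (expC z)), E; exact f0. }
  destruct (lift_2PI f F Fc HF) as [d Hd].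
  destruct (lift_2PI g K Kc HK) as [e He].
  exists F, (IZR d); repeat split; trivial.
  (* Since [g] inverts [f], [K (F z)] is a logarithm of [expC z], hence differs from [z] by a
     constant. Comparing [z = 0] with [z = 2 pi i] then gives [d * e = 1] for the two integer
     degrees. *)
  assert (KF : forall z, (K (F z) - z)%C = (K (F 0%C) - 0)%C).
  { apply (expC_const (fun z => K (F z) - z)%C 1%C).
    - intros z; apply continuous_Cminus; [|apply continuous_id].
      apply (continuous_comp F K); [apply Fc | apply Kc].
    - intros z; rewrite expC_minus, HK, HF, gf; field; apply expC_neq_0. }
  specialize (KF (0 + (0, 2 * PI)%R)%C); rewrite Hd in KF.
  replace (0, IZR d * (2 * PI)) with (IZR d * (0, 2 * PI)%R)%C in KF
    by (apply injective_projections; simpl; ring).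
  rewrite (quasi_period_Z _ _ _ d He) in KF.
  apply (f_equal snd) in KF; simpl in KF.
  assert (P := PI_RGT_0).
  assert (E : IZR (d * e) = IZR 1).
  { rewrite mult_IZR; apply (Rmult_eq_reg_r (2 * PI)); lra. }
  apply eq_IZR in E.
  destruct (Z.mul_eq_1 d e E) as [-> | ->]; [now left | now right].
Qed.

(** As [n] grows, [exp (n u)] tends to [0], so its image [exp (F 0 + n v)] does too. Once that image
    has modulus below [exp (Re (F 0))], the modulus of [f 1], the real part of [n v] is negative. *)
Lemma lift_contracts (f F : C -> C) (u v : C) :
  continuous f (RtoC 0) -> f 0%C = 0%C -> (forall z, expC (F z) = f (expC z)) ->
  quasi_period F u v -> fst u < 0 -> fst v < 0.
Proof.
  intros Hf f0 HF Q Hu.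
  destruct (proj1 (continuous_C_iff f 0%C) Hf (exp (fst (F 0%C))) (exp_pos _))
    as [d [d0 Hd]].
  destruct (INR_archimed (- fst u) (- ln d)) as [n Hn]; [lra|].
  assert (n0 := pos_INR n).
  specialize (Hd (expC (INR n * u)%C)).
  rewrite <- HF, f0 in Hd.
  replace (INR n * u)%C with (0 + INR n * u)%C in Hd at 2 by ring.
  rewrite (quasi_period_nat F u v n Q) in Hd.
  unfold Cminus in Hd; rewrite !Copp_0, !Cplus_0_r, !Cmod_expC in Hd.
  simpl in Hd; rewrite Rmult_0_l, Rminus_0_r in Hd.
  apply exp_lt_inv in Hd.
  - nra.
  - rewrite <- (exp_ln d d0) at 1; apply exp_increasing; lra.
Qed.

Lemma lift_slope_pos (f F : C -> C) (u v : C) :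
  continuous f (RtoC 0) -> f 0%C = 0%C -> (forall z, expC (F z) = f (expC z)) ->
  quasi_period F u v -> fst u <> 0 -> 0 < fst v / fst u.
Proof.
  intros Hf f0 HF Q Hu.
  destruct (Rtotal_order (fst u) 0) as [L | [L | L]]; [|contradiction|].
  - assert (V := lift_contracts f F u v Hf f0 HF Q L).
    replace (fst v / fst u) with (- fst v / - fst u) by (field; lra).
    apply Rdiv_lt_0_compat; lra.
  - assert (V := lift_contracts f F _ _ Hf f0 HF (quasi_period_opp _ _ _ Q)).
    simpl in V; apply Rdiv_lt_0_compat; lra.
Qed.

Lemma equivariant_lift (I : Type) (p q : I -> C) (f g : C -> C) :
  (forall r, p r <> 0%C) ->
  (forall z, continuous f z) -> (forall z, continuous g z) ->
  (forall z, g (f z) = z) -> (forall z, f (g z) = z) -> f 0%C = 0%C ->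
  (forall r w, f (p r * w)%C = (q r * f w)%C) ->
  exists (c : C) (s : R), 0 < fst c /\ (s = 1 \/ s = -1) /\
    forall r, exists u, expC u = p r /\ expC (shear c s u) = q r.
Proof.
  intros Hp Hf Hg gf fg f0 Heq.
  destruct (homeo_lift f g Hf Hg gf fg f0) as (F & s & Hs & Fc & HF & F2).
  assert (UV : forall r, exists u v, expC u = p r /\ expC v = q r /\ quasi_period F u v).
  { intros r; destruct (expC_surj (p r) (Hp r)) as [u Hu].
    destruct (lift_quasi_period f F _ _ u Fc HF (Heq r) Hu) as [v [Hv Q]].
    now exists u, v. }
  destruct (classic (exists u0 v0, fst u0 <> 0 /\ quasi_period F u0 v0))
    as [(u0 & v0 & H0 & Q0) | N].
  (* Solved from [shear c s u0 = v0]. The subtracted term is imaginary, so [fst c] is the positive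
     slope [fst v0 / fst u0]. *)
  - set (c := ((/ fst u0)%R * (v0 - (0, s * snd u0)%R))%C).
    assert (Hc : shear c s u0 = v0).
    { unfold c; apply injective_projections; simpl; field; lra. }
    exists c, s; split; [|split; [exact Hs|]].
    + assert (V := lift_slope_pos f F u0 v0 (Hf _) f0 HF Q0 H0).
      replace (fst c) with (fst v0 / fst u0); [exact V|].
      unfold c; simpl; field; lra.
    + intros r; destruct (UV r) as (u & v & Hu & Hv & Q); exists u; split; [exact Hu|].
      rewrite <- (quasi_period_shear F c s u v Fc F2 Q); [exact Hv|].
      right; exists u0; now rewrite Hc.
  (* All quasi-periods are imaginary, where [shear c s] takes the same values for every [c]; [c = 1]
     has positive real part. *)
  - exists 1%C, s; split; [simpl; lra | split; [exact Hs|]].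
    intros r; destruct (UV r) as (u & v & Hu & Hv & Q); exists u; split; [exact Hu|].
    rewrite <- (quasi_period_shear F 1%C s u v Fc F2 Q); [exact Hv|].
    left; apply NNPP; intros Hre; apply N; now exists u, v.
Qed.

(** * Power maps *)

Lemma Rcpow_expC (t : R) (a : C) : Rcpow t a = expC (ln t * a)%C.
Proof. unfold Rcpow; change Cexp with expC; f_equal; apply injective_projections; simpl; ring. Qed.

(* [w |w|^a]; the junk value [ln 0] is harmless because of the factor [w]. *)
Definition power_map (a w : C) : C := (w * expC (ln (Cmod w) * a))%C.

Lemma power_map_0 (a : C) : power_map a 0%C = 0%C.
Proof. apply Cmult_0_l. Qed.

Lemma Cmod_power_map (a w : C) :
  w <> 0%C -> Cmod (power_map a w) = exp ((1 + fst a) * ln (Cmod w)).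
Proof.
  intros Hw; apply Cmod_gt_0 in Hw; unfold power_map.
  rewrite Cmod_mult, Cmod_expC, <- (exp_ln (Cmod w) Hw) at 1.
  rewrite <- exp_plus; f_equal; simpl; ring.
Qed.

Lemma power_map_mult (a z w : C) :
  z <> 0%C -> power_map a (z * w)%C = (power_map a z * power_map a w)%C.
Proof.
  intros Hz; destruct (classic (w = 0%C)) as [-> | Hw].
  - now rewrite Cmult_0_r, power_map_0, Cmult_0_r.
  - unfold power_map; rewrite Cmod_mult, ln_mult by now apply Cmod_gt_0.
    rewrite RtoC_plus, Cmult_plus_distr_r, expC_plus; ring.
Qed.

(** Since [power_map a w] has modulus [|w|^(1 + Re a)], the composite multiplies [w] by [|w|] to the
    power [a + (1 + Re a) b]. *)
Lemma power_map_cancel (a b w : C) :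
  (a + (1 + fst a)%R * b)%C = 0%C -> power_map b (power_map a w) = w.
Proof.
  intros E; destruct (classic (w = 0%C)) as [-> | Hw].
  - now rewrite !power_map_0.
  - unfold power_map at 1; rewrite Cmod_power_map, ln_exp by exact Hw.
    unfold power_map; rewrite <- Cmult_assoc, <- expC_plus.
    replace (ln (Cmod w) * a + ((1 + fst a) * ln (Cmod w))%R * b)%C
      with (ln (Cmod w) * (a + (1 + fst a)%R * b))%C
      by (rewrite RtoC_mult; ring).
    rewrite E, Cmult_0_r, expC_0; ring.
Qed.

Lemma continuous_power_map (a w : C) : 0 < 1 + fst a -> continuous (power_map a) w.
Proof.
  intros Ha; destruct (classic (w = 0%C)) as [-> | Hw].
  - apply continuous_C_iff; intros e He.
    (* This is [e] to the power [1 / (1 + Re a)], the inverse of the growth [|z|^(1 + Re a)]. *)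
    exists (exp (ln e / (1 + fst a))); split; [apply exp_pos|]; intros z Hz.
    rewrite power_map_0; unfold Cminus in *; rewrite Copp_0, Cplus_0_r in *.
    destruct (classic (z = 0%C)) as [-> | Hz0].
    + now rewrite power_map_0, Cmod_0.
    + rewrite Cmod_power_map by exact Hz0.
      apply Cmod_gt_0 in Hz0.
      rewrite <- (exp_ln (Cmod z) Hz0) in Hz; apply exp_lt_inv in Hz.
      rewrite <- (exp_ln e He); apply exp_increasing.
      apply Rlt_div_r in Hz; [|exact Ha]; rewrite Rmult_comm; exact Hz.
  - apply continuous_Cmult; [apply continuous_id|].
    apply continuous_expC, continuous_Cmult; [|apply continuous_const].
    apply continuous_Cpair; [|apply continuous_const].
    apply (continuous_comp Cmod ln).
    + apply (continuous_Cmod (fun z => z)), continuous_id.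
    + now apply continuous_ln, Cmod_gt_0.
Qed.

Lemma continuous_Cconj (z : C) : continuous Complex.Cconj z.
Proof.
  apply continuous_Cpair; [|apply (continuous_opp (V := R_NormedModule))].
  - apply (continuous_Cfst (fun z => z)), continuous_id.
  - apply (continuous_Csnd (fun z => z)), continuous_id.
Qed.

Lemma power_map_homeo (a : C) : 0 < 1 + fst a ->
  exists g : C -> C, (forall z, g (power_map a z) = z) /\
    (forall z, power_map a (g z) = z) /\ (forall z, continuous g z).
Proof.
  intros Ha; exists (power_map ((- / (1 + fst a))%R * a)%C); repeat split; intros z.
  - apply power_map_cancel; apply injective_projections; simpl; field; lra.
  - apply power_map_cancel; apply injective_projections; simpl; field; lra.
  - apply continuous_power_map; simpl.
    (* The inverse exponent [b] satisfies [1 + Re b = 1 / (1 + Re a)], so it again meets the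
       condition for continuity. *)
    replace (_ + _) with (/ (1 + fst a)) by (field; lra).
    now apply Rinv_0_lt_compat.
Qed.

(** The real part of [u] is the logarithm of [|exp u|], so the part [(c - 1) Re u] becomes a power
    of the modulus. What remains is [exp u] for [s = 1] and its conjugate for [s = -1]. *)
Lemma expC_shear (c : C) (s : R) (u : C) :
  expC (shear c s u) = power_map (c - 1) (expC (fst u, s * snd u)).
Proof.
  unfold power_map; rewrite Cmod_expC, ln_exp, <- expC_plus; f_equal.
  apply injective_projections; simpl; ring.
Qed.

(** * The equivariance criterion *)

Lemma equivariant_power (I : Type) (p q : I -> C) (f g : C -> C) :
  (forall r, p r <> 0%C) ->
  (forall z, continuous f z) -> (forall z, continuous g z) ->
  (forall z, g (f z) = z) -> (forall z, f (g z) = z) ->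
  (forall r w, f (p r * w)%C = (q r * f w)%C) ->
  exists a : C, -1 < fst a /\
    ((forall r, q r = power_map a (p r)) \/
     (forall r, q r = power_map a (Complex.Cconj (p r)))).
Proof.
  intros hp Hf Hg gf fg Heq.
  destruct (classic (exists r, p r <> 1%C)) as [[r0 Hr0] | N].
  (* At [w = 0] the equation reads [f 0 = q f 0]. If [f 0] were nonzero then [q = 1], whence
     [f p = f 1] and, by injectivity, [p = 1]. *)
  - assert (f0 : f 0%C = 0%C).
    { assert (E := Heq r0 0%C); rewrite Cmult_0_r in E.
      apply NNPP; intros F0; apply Hr0.
      assert (Q1 : q r0 = 1%C).
      { replace (q r0) with (q r0 * f 0%C / f 0%C)%C by (field; exact F0).
        rewrite <- E; field; exact F0. }
      rewrite <- (gf (p r0)), <- (gf 1%C), <- (Cmult_1_r (p r0)), Heq, Q1.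
      now rewrite Cmult_1_l. }
    destruct (equivariant_lift I p q f g hp Hf Hg gf fg f0 Heq)
      as (c & s & Hc & Hs & Hr).
    exists (c - 1)%C; split; [simpl; lra|].
    destruct Hs as [-> | ->]; [left | right]; intros r;
      destruct (Hr r) as (u & <- & <-); rewrite expC_shear; f_equal.
    + f_equal; apply injective_projections; simpl; ring.
    + apply injective_projections; simpl; replace (-1 * snd u) with (- snd u) by ring.
      * now rewrite cos_neg.
      * rewrite sin_neg; ring.
  (* When every multiplier is 1, [f] may be a translation and need not fix [0]. Evaluating at the
     preimage [g 1] of [1] gives [q r = 1], so exponent [0] works. *)
  - assert (P1 : forall r, p r = 1%C)
      by (intros r; apply NNPP; intros H; apply N; now exists r).
    exists 0%C; split; [simpl; lra|]; left; intros r.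
    assert (E := Heq r (g 1%C)).
    rewrite P1, Cmult_1_l, fg, Cmult_1_r in E.
    unfold power_map; now rewrite Cmult_0_r, expC_0, P1, Cmult_1_l.
Qed.

Theorem theorem3p1 (I : Type) (p q : I -> Cplx)
  (hp : forall r, p r <> C0) (hq : forall r, q r <> C0) :
  (exists f : Cplx -> Cplx, Chomeomorphism f /\
     forall r w, f (Cmul (p r) w) = Cmul (q r) (f w))
  <->
  (exists alpha : Cplx, Re alpha > -1 /\
     ((forall r, q r = Cmul (p r) (Rcpow (Cnorm (p r)) alpha)) \/
      (forall r, q r = Cmul (Cconj (p r)) (Rcpow (Cnorm (p r)) alpha)))).
Proof.
  assert (direct : forall a r,
    Cmul (p r) (Rcpow (Cnorm (p r)) a) = power_map a (p r)).
  { intros a r; rewrite Rcpow_expC, Cnorm_Cmod; reflexivity. }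
  assert (conjugate : forall a r,
    Cmul (Cconj (p r)) (Rcpow (Cnorm (p r)) a) = power_map a (Complex.Cconj (p r))).
  { intros a r; unfold power_map.
    rewrite Rcpow_expC, Cnorm_Cmod, Cmod_conj; reflexivity. }
  split.
  - intros (f & (g & gf & fg & Hf & Hg) & Heq).
    rewrite Ccontinuous_iff in Hf, Hg.
    destruct (equivariant_power I p q f g hp Hf Hg gf fg Heq) as (a & Ha & Hor).
    exists a; split; [exact Ha|].
    destruct Hor as [H | H]; [left | right]; intros r;
      [rewrite direct | rewrite conjugate]; apply H.
  - intros (a & Ha & Hor); unfold Re in Ha.
    assert (Ha' : 0 < 1 + fst a) by lra.
    destruct (power_map_homeo a Ha') as (g & gf & fg & Hg).
    assert (Hf := fun w => continuous_power_map a w Ha').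
    destruct Hor as [Hq | Hq].
    + exists (power_map a); split.
      * exists g; rewrite !Ccontinuous_iff; auto.
      * intros r w; rewrite Hq, direct; exact (power_map_mult a (p r) w (hp r)).
    + exists (fun w => power_map a (Complex.Cconj w)); split.
      * exists (fun w => Complex.Cconj (g w)); rewrite !Ccontinuous_iff.
        repeat split; intros z.
        -- rewrite gf; apply Complex.Cconj_conj.
        -- rewrite Complex.Cconj_conj; apply fg.
        -- apply (continuous_comp Complex.Cconj (power_map a));
             [apply continuous_Cconj | apply Hf].
        -- apply (continuous_comp g Complex.Cconj); [apply Hg | apply continuous_Cconj].
      * intros r w; rewrite Hq, conjugate.
        refine (eq_trans (f_equal (power_map a) (Cmult_conj (p r) w)) _).
        apply power_map_mult; apply Cmod_gt_0; rewrite Cmod_conj.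
        apply Cmod_gt_0, hp.
Qed.
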